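(* No tournament on $7$ vertices is intrinsically linked as a directed graph.
   Context: A tournament on $n$ vertices is a directed graph on $n$ vertices with exactly one directed edge between each pair of distinct vertices (equivalently, the complete graph $K_n$ with a choice of orientation of each edge). Embeddings are embeddings of the graph in $S^3$, in the usual (tame) sense of spatial graph theory. A cycle in a directed graph means a cycle of the underlying undirected graph; it is consistently oriented if its edges all point the same way around the cycle (i.e. it is a directed cycle). A directed graph $G$ is intrinsically linked as a directed graph (digraph) if every embedding of $G$ in $S^3$ contains a non-split link (with at least two components), formed by pairwise disjoint cycles of $G$, each of which is consistently oriented. *)

(* Defs.v *)
From HB Require Import structures.
From mathcomp Require Import all_boot all_order all_algebra.
From mathcomp Require Import all_classical all_reals all_analysis.
Set Implicit Arguments.
Unset Strict Implicit.
Unset Printing Implicit Defensive.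
Import Order.TTheory GRing.Theory Num.Theory numFieldNormedType.Exports.
Local Open Scope classical_set_scope.
Local Open Scope ring_scope.

Definition usphere (R : realType) (n : nat) : set 'rV[R]_n.+1 :=
  [set x | \sum_i x ord0 i ^+ 2 = 1].

Arguments usphere : clear implicits.

Notation S2 R := (usphere R 2).
Notation S3 R := (usphere R 3).

Definition S3_homeo (R : realType) (h : 'rV[R]_4 -> 'rV[R]_4) : Prop :=
  exists g : 'rV[R]_4 -> 'rV[R]_4,
    [/\ set_fun (S3 R) (S3 R) h, set_fun (S3 R) (S3 R) g,
        {within S3 R, continuous h}, {within S3 R, continuous g} &
        forall x, S3 R x -> g (h x) = x /\ h (g x) = x].

(* The great-sphere simplex spanned by the rows of A, cut out of the 3-sphere
   by the cone on these rows; rows may be repeated or dependent, so simplices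
   of every dimension at most 3 are covered. *)
Definition spherical_simplex (R : realType) (A : 'M[R]_4) : set 'rV[R]_4 :=
  S3 R `&` [set x | exists a : 'rV[R]_4,
                      (forall i, 0 <= a ord0 i) /\ x = a *m A].

Definition polyhedron (R : realType) (X : set 'rV[R]_4) : Prop :=
  exists s : seq 'M[R]_4, X = \bigcup_(A in [set` s]) spherical_simplex A.

Definition tame (R : realType) (X : set 'rV[R]_4) : Prop :=
  exists h : 'rV[R]_4 -> 'rV[R]_4, S3_homeo h /\ polyhedron (h @` X).

Definition embedded_sphere (R : realType) (F : set 'rV[R]_4) : Prop :=
  [/\ F `<=` S3 R, tame F &
      exists f : 'rV[R]_3 -> 'rV[R]_4,
        [/\ {within S2 R, continuous f}, set_inj (S2 R) f & f @` S2 R = F]].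

(* L i is the i-th component of the link; the sphere F has components of the
   link on both of its sides. *)
Definition split_link (R : realType) (n : nat) (L : 'I_n -> set 'rV[R]_4) :
    Prop :=
  exists F : set 'rV[R]_4,
    [/\ embedded_sphere F, forall i, F `&` L i = set0 &
        exists i j x y, [/\ L i x, L j y &
          ~ connected_component (S3 R `\` F) x y]].

(* A relation e on V is read as the set of directed edges u -> v, e u v. *)
Definition tournament (V : finType) (e : rel V) : Prop :=
  (forall u, ~~ e u u) /\ (forall u v, u != v -> e u v (+) e v u).

(* In an oriented graph (no loop, no pair of opposite edges) a cycle of the
   underlying simple graph is given by the sequence of its vertices. *)
Definition graph_cycle (V : finType) (e : rel V) (c : seq V) : bool :=
  [&& (2 < size c)%N, uniq c & cycle (fun u v => e u v || e v u) c].

Definition consistently_oriented (V : finType) (e : rel V) (c : seq V) : bool :=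
  cycle e c || cycle e (rev c).

(* A topological embedding in S^3 of the realization of the digraph e: the
   vertex v is placed at vtx v, and the edge u -> v is parametrized over
   [0, 1] by edge_arc u v; the values of edge_arc at non-edges are irrelevant. *)
Record graph_embedding (R : realType) (V : finType) (e : rel V) : Type :=
  GraphEmbedding {
    vtx : V -> 'rV[R]_4;
    edge_arc : V -> V -> R -> 'rV[R]_4;
    vtx_S3 : forall v, S3 R (vtx v);
    vtx_inj : injective vtx;
    arc_S3 : forall u v, e u v -> set_fun `[0, 1] (S3 R) (edge_arc u v);
    arc_continuous : forall u v, e u v ->
      {within `[0, 1], continuous (edge_arc u v)};
    arc_ends : forall u v, e u v -> edge_arc u v 0 = vtx u /\ edge_arc u v 1 = vtx v;
    arc_vtx : forall u v w (t : R), e u v -> t \in `]0, 1[ -> edge_arc u v t <> vtx w;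
    arc_inj : forall u v u' v' (t t' : R), e u v -> e u' v' ->
      t \in `]0, 1[ -> t' \in `]0, 1[ -> edge_arc u v t = edge_arc u' v' t' ->
      (u, v, t) = (u', v', t')
  }.

Section Images.
Variables (R : realType) (V : finType) (e : rel V) (G : graph_embedding R e).

Definition graph_image : set 'rV[R]_4 :=
  range (vtx G) `|`
  \bigcup_(p in [set p : V * V | e p.1 p.2]) (edge_arc G p.1 p.2 @` `[0, 1]).

Definition cycle_image (c : seq V) : set 'rV[R]_4 :=
  \bigcup_(p in [set p : V * V |
      [/\ e p.1 p.2, p.1 \in c, p.2 \in c &
          (p.2 == next c p.1) || (p.1 == next c p.2)]])
    (edge_arc G p.1 p.2 @` `[0, 1]).

End Images.

Definition intrinsically_linked_digraph (R : realType) (V : finType)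
    (e : rel V) : Prop :=
  forall G : graph_embedding R e, tame (graph_image G) ->
    exists (n : nat) (c : 'I_n -> seq V),
      [/\ (1 < n)%N,
          forall i, graph_cycle e (c i) /\ consistently_oriented e (c i),
          forall i j : 'I_n, i != j -> [disjoint c i & c j]%bool &
          ~ split_link (fun i => cycle_image G (c i))].

(* Main.v *)
Require Import Defs.
From mathcomp Require Import all_boot all_order all_algebra.
From mathcomp Require Import all_classical all_reals all_analysis.
From mathcomp Require Import zify ring lra.
Set Implicit Arguments.
Unset Strict Implicit.
Unset Printing Implicit Defensive.
Import Order.TTheory GRing.Theory Num.Theory numFieldNormedType.Exports.

(** Put the seven vertices on the rays spanned by (-1)^t (1, t, t^2, t^3) for
t = 0, ..., 6 and join them by great-circle arcs. Linear functionals evaluate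
to (-1)^t p(t) with p a cubic polynomial, so the arc uv misses the spherical
triangle abc as soon as some cubic p makes (-1)^t p(t) positive on a, b, c and
negative on u, v. If a cycle misses a triangle in this way, the boundary of a
thin tetrahedral cone around the triangle splits the two cycles apart. Only 21
pairs of disjoint cycles (seven of two triangles, fourteen of a triangle and a
quadrilateral) are not split in this way. A tournament has a Hamiltonian path,
and with the vertices numbered along it one of 14 placements of the vertices
makes none of these 21 pairs consistently oriented. *)

(** * The placement of the vertices *)

Definition edges (T : Type) (c : seq T) : seq (T * T) := zip c (rot 1 c).

(* The sign of (-1)^t p(t), where p is the cubic with roots r + 1/2 for r in h.2
   and with leading coefficient (-1)^h.1; true stands for a negative value. *)
Definition side (h : bool * seq nat) (t : nat) : bool :=
  h.1 (+) odd t (+) odd (count (leq t) h.2).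

Fixpoint words (k : nat) : seq (seq nat) :=
  if k is k'.+1 then [seq i :: w | i <- iota 0 7, w <- words k'] else [:: [::]].

(* The roots are put between the neighbours at which the prescribed values of p
   change sign, that of (-1)^t p(t) being positive exactly on tri. *)
Definition separator (tri : seq nat) (d : nat * nat) : bool * seq nat :=
  let s := [seq t <- iota 0 7 | (t == d.1) || (t == d.2) || (t \in tri)] in
  let rs := [seq z.1 | z <- zip s (behead s) &
                       odd z.1 (+) odd z.2 (+) (z.1 \in tri) (+) (z.2 \in tri)] in
  (side (false, rs) (head 0 tri), rs).

(** The signs are checked afresh at all the points concerned, so nothing has to be proved about how
    [separator] chooses its roots. *)
Definition separable (tri : seq nat) (d : nat * nat) : bool :=
  let h := separator tri d in
  [&& size h.2 <= 3, ~~ has (side h) tri, side h d.1 & side h d.2].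

Definition avoids (tri c : seq nat) : bool := all (separable tri) (edges c).

(* Starting at the least vertex selects one rotation of each oriented cycle. *)
Definition cycles (k : nat) : seq (seq nat) :=
  [seq w <- words k | uniq w & all (leq (head 0 w)) w].

(* A conservative test: [linked] only says that the criterion [avoids] fails. *)
Definition linked (l : seq nat * seq nat) : bool :=
  [&& ~~ has (mem l.1) l.2, ~~ avoids l.1 l.2 &
      (size l.2 == 3) ==> ~~ avoids l.2 l.1].

(** Disjoint cycles on at most seven vertices have lengths 3 and 3, or 3 and 4, so one of them is a
    triangle and can be put first. *)
Definition links : seq (seq nat * seq nat) :=
  [seq l <- [seq (p, q) | p <- cycles 3, q <- cycles 3 ++ cycles 4] | linked l].

(** * The search over the directions of the arcs *)

Definition clause := seq (nat * nat).

(* A clause lists the arcs of two oriented cycles; it is refuted when one of the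
   arcs is reversed. *)
Definition assume (d : nat * nat) (cs : seq clause) : seq clause :=
  [seq rem d c | c <- cs & (d.2, d.1) \notin c].

(** An empty clause is a pair of cycles whose arcs all agree with the directions assumed so far; the
    placement it belongs to is given up. *)
Definition prune (d : nat * nat) (css : seq (seq clause)) : seq (seq clause) :=
  [seq cs <- [seq assume d cs | cs <- css] | [::] \notin cs].

(* Each element of [css] is the system of clauses of one placement; the directions
   of the arcs [ds] are branched on until some system is entirely refuted. *)
Fixpoint solve (ds : seq (nat * nat)) (css : seq (seq clause)) : bool :=
  if [::] \in css then true else
  if ds is d :: ds' then
    if solve ds' (prune d css) then solve ds' (prune (d.2, d.1) css) else false
  else false.

(** Entry t of a list is the position along the Hamiltonian path of the vertex placed at the point t
    of the curve. The choice of lists is justified by [systems_solved] alone. *)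
Definition labellings : seq (seq nat) :=
  [:: [:: 0; 2; 4; 6; 1; 3; 5]; [:: 0; 3; 6; 2; 5; 1; 4]; [:: 0; 1; 3; 4; 2; 6; 5];
      [:: 0; 3; 2; 5; 4; 1; 6]; [:: 0; 4; 3; 5; 1; 2; 6]; [:: 0; 4; 3; 2; 1; 6; 5];
      [:: 0; 2; 1; 4; 3; 6; 5]; [:: 0; 1; 5; 6; 3; 2; 4]; [:: 0; 1; 2; 3; 5; 4; 6];
      [:: 0; 3; 5; 6; 1; 2; 4]; [:: 0; 1; 3; 4; 5; 2; 6]; [:: 0; 1; 4; 6; 3; 2; 5];
      [:: 0; 1; 2; 5; 6; 3; 4]; [:: 0; 1; 2; 3; 4; 5; 6]].

Definition relabel (s : seq nat) (c : clause) : clause :=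
  [seq (nth 0 s d.1, nth 0 s d.2) | d <- c].

Definition clauses : seq clause := [seq edges l.1 ++ edges l.2 | l <- links].

Definition systems : seq (seq clause) :=
  [seq [seq relabel s c | c <- clauses] | s <- labellings].

(** Of the 21 pairs of positions, these 6 are directed by the Hamiltonian path; [other_arcs] lists
    the remaining 15, with i at most j - 2. *)
Definition path_arcs := zip (iota 0 6) (iota 1 6).
Definition other_arcs := [seq (i, j) | j <- iota 0 7, i <- iota 0 j.-1].

Section Clauses.
Variable E : rel nat.

Definition holds (c : clause) : bool := all (fun d => E d.1 d.2) c.
Definition refuted (cs : seq clause) : bool := ~~ has holds cs.

(** A clause that holds cannot contain the reverse of [d], so it survives the filter, and it still
    holds once [d] is removed from it. *)
Lemma refuted_assume d cs :
  ~~ E d.2 d.1 -> refuted (assume d cs) -> refuted cs.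
Proof.
move=> nE; apply: contra => /hasP[c cC Ec]; apply/hasP; exists (rem d c).
  apply/map_f; rewrite mem_filter cC andbT.
  by apply: contra nE => /(allP Ec).
by apply/allP => x /mem_rem /(allP Ec).
Qed.

Lemma refuted_prune d css :
  ~~ E d.2 d.1 -> has refuted (prune d css) -> has refuted css.
Proof.
move=> nE /hasP[cs]; rewrite mem_filter => /andP[_ /mapP[cs' cs'C ->]] rcs.
by apply/hasP; exists cs' => //; apply: refuted_assume rcs.
Qed.

Lemma refuted_foldr_prune ds css : all (fun d => ~~ E d.2 d.1) ds ->
  has refuted (foldr prune css ds) -> has refuted css.
Proof. by elim: ds => //= d ds IH /andP[nE nEs] /(refuted_prune nE) /(IH nEs). Qed.

(** For a given [E] only the branch that agrees with the direction of [d] matters. Pruning there may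
    drop systems, but a refuted one that remains comes from a refuted one of [css]. *)
Lemma solve_refuted ds css : all (fun d => E d.1 d.2 (+) E d.2 d.1) ds ->
  solve ds css -> has refuted css.
Proof.
elim: ds css => [|d ds IH] css /=.
  by case: ifP => // nil_css _ _; apply/hasP; exists [::].
case: ifP => [nil_css _ _|_ /andP[Ed Eds]]; first by apply/hasP; exists [::].
case: ifP => // s1 s2; have [E21|nE21] := boolP (E d.2 d.1).
  by apply: refuted_prune (IH _ Eds s2); rewrite E21 addbT in Ed.
exact: refuted_prune (IH _ Eds s1).
Qed.

End Clauses.

Lemma mem_words k w : (w \in words k) = (size w == k) && all (ltn^~ 7) w.
Proof.
elim: k w => [|k IH] w; first by case: w.
apply/(@allpairsP _ _ _ _ (iota 0 7))/andP => [[[i v]]|].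
  rewrite IH mem_iota /= => -[i7 /andP[sv v7] ->] /=.
  by rewrite eqSS sv i7.
case: w => [[]//|i w [/eqP[sw] /andP[i7 w7]]].
by exists (i, w); rewrite mem_iota IH; split=> //; apply/andP; rewrite sw.
Qed.

Lemma all_edges (T : Type) (e : rel T) c :
  all (fun d => e d.1 d.2) (edges c) = cycle e c.
Proof.
case: c => // x c; rewrite /edges rot1_cons /=.
elim: c {1 3}x => [|z c IH] y /=; first by rewrite andbT.
by rewrite IH.
Qed.

Lemma edges_map (T T' : Type) (f : T -> T') c :
  edges (map f c) = [seq (f d.1, f d.2) | d <- edges c].
Proof.
rewrite /edges -map_rot; elim: c (rot 1 c) => [|x c IH] [|y d] //=.
by rewrite IH.
Qed.

(** With the path arcs fixed there are 2^15 tournaments left; a branch is closed as soon as one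
    placement has all its clauses refuted. *)
Lemma systems_solved : solve other_arcs (foldr prune systems path_arcs).
Proof. by vm_compute. Qed.

Lemma hamiltonian_path (V : finType) (e : rel V) :
  (forall u v, u != v -> e u v (+) e v u) ->
  exists s : seq V, [/\ uniq s, s =i V & sorted e s].
Proof.
move=> he; pose le u v := (u == v) || e u v.
have le_total : total le.
  move=> u v; rewrite /le [v == u]eq_sym; case: eqVneq => //= /he.
  by case: (e u v) => //= ->.
(* Merge sort only needs totality to return a sorted sequence. *)
exists (sort le (enum V)); split.
- by rewrite sort_uniq enum_uniq.
- by move=> v; rewrite mem_sort mem_enum.
have : sorted le (sort le (enum V)) by apply: sort_sorted.
have : uniq (sort le (enum V)) by rewrite sort_uniq enum_uniq.
case: (sort _ _) => // x p; elim: p x => //= y p IH x /andP[].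
rewrite inE negb_or => /andP[xy _] up /andP[]; rewrite /le (negbTE xy) /= => -> /=.
exact: IH.
Qed.

Lemma mem_cycles k w : uniq w -> size w = k -> all (ltn^~ 7) w ->
  all (leq (head 0 w)) w -> w \in cycles k.
Proof. by move=> uw sw w7 hw; rewrite mem_filter uw hw mem_words sw eqxx w7. Qed.

Lemma mem_links p q : p \in cycles 3 -> (q \in cycles 3) || (q \in cycles 4) ->
  linked (p, q) -> (p, q) \in links.
Proof.
move=> pc qc pq; rewrite mem_filter pq.
by apply: (allpairs_f pair pc); rewrite mem_cat.
Qed.

(** The list [s] is the Hamiltonian path permuted by a labelling whose system is refuted, so that
    [index^~ s] gives the point of the curve. The conditions on [head] select the rotations
    enumerated by [cycles]. *)
Lemma placement (V : finType) (e : rel V) :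
  (forall u, ~~ e u u) -> (forall u v, u != v -> e u v (+) e v u) -> #|V| = 7 ->
  exists s : seq V, [/\ uniq s, s =i V, size s = 7 &
    forall c c', let p := map (index^~ s) c in let q := map (index^~ s) c' in
      cycle e c -> uniq c -> size c = 3 -> all (leq (head 0 p)) p ->
      cycle e c' -> uniq c' -> size c' = 3 \/ size c' = 4 -> all (leq (head 0 q)) q ->
      ~~ linked (p, q)].
Proof.
move=> irr he V7; have [s0 [us0 ms0 ss0]] := hamiltonian_path he.
have sz0 : size s0 = 7.
  by rewrite -V7 -(card_uniqP us0); apply: eq_card.
have [x0 _] : exists x0 : V, x0 \in s0.
  by case: (s0) sz0 => // x ? _; exists x; rewrite inE eqxx.
pose w i := nth x0 s0 i; pose E i j := e (w i) (w j).
have winj i j : i < 7 -> j < 7 -> w i = w j -> i = j.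
  by move=> i7 j7 /eqP; rewrite nth_uniq ?sz0// => /eqP.
have Etour i j : i < 7 -> j < 7 -> i != j -> E i j (+) E j i.
  by move=> i7 j7 ij; apply: he; apply: contra ij => /eqP/winj->.
have hamE : all (fun d => ~~ E d.2 d.1) path_arcs.
  have hE i : i.+1 < 7 -> ~~ E i.+1 i.
    move=> i7; have := Etour i i.+1; rewrite i7 ltnW// => /(_ isT isT).
    rewrite neq_ltn ltnSn => /(_ isT).
    by rewrite {1}/E (elimT (sortedP x0) ss0 i) ?sz0.
  by rewrite /= !hE.
have othersE : all (fun d => E d.1 d.2 (+) E d.2 d.1) other_arcs.
  apply/allP => -[i j] /allpairsPdep[j' [i' [jI iI [-> ->]]]] /=.
  move: jI iI; rewrite !mem_iota /= add0n => j7 ij.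
  by apply: Etour => //; [lia|lia].
have := refuted_foldr_prune hamE (solve_refuted othersE systems_solved).
case/hasP => _ /mapP[sg sgL ->] /hasPn ref.
have /and3P[usg ssg sg7] : [&& uniq sg, size sg == 7 & all (ltn^~ 7) sg].
  have labP : all (fun sg => [&& uniq sg, size sg == 7 & all (ltn^~ 7) sg]) labellings.
    by [].
  exact: (allP labP).
have us : uniq (map w sg).
  by rewrite map_inj_in_uniq// => i j /(allP sg7) i7 /(allP sg7) j7; apply: winj.
have ss : size (map w sg) = 7 by rewrite size_map (eqP ssg).
exists (map w sg).
have ms : map w sg =i V.
  apply/subset_cardP; last by apply/fintype.subsetP.
  by rewrite V7 -ss; apply/card_uniqP.
have posI m c : size c = m -> uniq c ->
    all (leq (head 0 (map (index^~ (map w sg)) c))) (map (index^~ (map w sg)) c) ->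
    map (index^~ (map w sg)) c \in cycles m.
  move=> sc uc; apply: mem_cycles; rewrite ?size_map//.
    rewrite map_inj_uniq// => u v /(congr1 (nth u (map w sg))).
    by rewrite !nth_index ?ms.
  by apply/allP => _ /mapP[v _ ->]; rewrite /= -ss index_mem ms.
split=> // c c' /= ce uc sc hc ce' uc' sc' hc'; apply/negP => /mem_links pqL.
have {}pqL : (map (index^~ (map w sg)) c, map (index^~ (map w sg)) c') \in links.
  apply: pqL; first exact: posI.
  by apply/orP; case: sc' => sc'; [left|right]; apply: posI.
(* For a linked pair the relabelled clause, read through [w], lists exactly the arcs of [c] and
   [c']; all of them are in [e], against [ref]. *)
have := ref _ (map_f (relabel sg) (map_f (fun l => edges l.1 ++ edges l.2) pqL)).
have wi v : w (nth 0 sg (index v (map w sg))) = v.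
  by rewrite -(nth_map 0 (w 0)) ?nth_index ?ms// -(size_map w) index_mem ms.
rewrite /holds /relabel all_map all_cat /= !edges_map !all_map.
by rewrite !(eq_all (a2 := fun d => e d.1 d.2)) ?all_edges ?ce ?ce'// => d /=;
  rewrite /E !wi.
Qed.

Local Open Scope classical_set_scope.
Local Open Scope ring_scope.

(** * Tetrahedral spheres *)

Section Normalize.
Variables (R : realType) (n : nat).
Implicit Types (x v : 'rV[R]_n.+1) (k : R).

Definition nrm v : R := Num.sqrt (\sum_i v ord0 i ^+ 2).
Definition normalize v : 'rV[R]_n.+1 := (nrm v)^-1 *: v.

Lemma sumsq_ge0 v : 0 <= \sum_i v ord0 i ^+ 2.
Proof. by apply: sumr_ge0 => i _; rewrite sqr_ge0. Qed.

Lemma nrm_gt0 v : v != 0 -> 0 < nrm v.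
Proof.
move=> v0; rewrite sqrtr_gt0 lt_neqAle sumsq_ge0 andbT; apply: contra v0.
rewrite eq_sym psumr_eq0 => [/allP v0|i _]; last by rewrite sqr_ge0.
apply/eqP/rowP => i; rewrite mxE; apply/eqP.
by rewrite -sqrf_eq0; apply: v0; rewrite mem_index_enum.
Qed.

Lemma nrmZ k v : 0 <= k -> nrm (k *: v) = k * nrm v.
Proof.
move=> k0; rewrite /nrm.
under eq_bigr do rewrite mxE exprMn.
by rewrite -mulr_sumr sqrtrM ?sqr_ge0// sqrtr_sqr ger0_norm.
Qed.

Lemma usphereP v : usphere R n v <-> nrm v = 1.
Proof.
rewrite /usphere/nrm/=; split=> [->|H]; first by rewrite sqrtr1.
by rewrite -(sqr_sqrtr (sumsq_ge0 v)) H expr1n.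
Qed.

Lemma usphere_neq0 v : usphere R n v -> v != 0.
Proof.
move=> /usphereP; apply: contra_eq_neq => ->.
by rewrite -(scale0r 0) nrmZ// mul0r eq_sym oner_eq0.
Qed.

Lemma normalize_usphere v : v != 0 -> usphere R n (normalize v).
Proof.
move=> v0; apply/usphereP.
by rewrite nrmZ ?mulVf ?invr_ge0 ?sqrtr_ge0// gt_eqF// nrm_gt0.
Qed.

Lemma normalizeZ k v : 0 < k -> normalize (k *: v) = normalize v.
Proof.
move=> k0; have [->|v0] := eqVneq v 0; first by rewrite scaler0.
rewrite /normalize nrmZ ?ltW// scalerA invfM mulrC mulrA divff ?mul1r//.
by rewrite gt_eqF.
Qed.

Lemma normalize_id v : usphere R n v -> normalize v = v.
Proof. by move=> /usphereP v1; rewrite /normalize v1 invr1 scale1r. Qed.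

Lemma normalize_eq u v : u != 0 -> v != 0 -> normalize u = normalize v ->
  exists2 k, 0 < k & u = k *: v.
Proof.
move=> u0 v0 uv; exists (nrm u / nrm v); first by rewrite divr_gt0 ?nrm_gt0.
rewrite -scalerA -[_ *: v]/(normalize v) -uv scalerA divff ?scale1r//.
by rewrite gt_eqF ?nrm_gt0.
Qed.

Lemma usphere_scale_inj k u v : usphere R n u -> usphere R n v -> 0 < k ->
  u = k *: v -> u = v.
Proof.
by move=> u1 v1 k0 uv; rewrite -(normalize_id u1) uv normalizeZ// normalize_id.
Qed.

Lemma nrm_continuous : continuous nrm.
Proof.
move=> v; apply: (@continuous_comp _ _ _ _ Num.sqrt); last exact: sqrt_continuous.
apply: (@continuous_big _ _ +%R 0 xpredT (@add_continuous R) _ _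
  (fun i (w : 'rV[R]_n.+1) => w ord0 i ^+ 2)).
move=> i _ w; apply: (@continuous_comp _ _ _ (fun w : 'rV[R]_n.+1 => w ord0 i)
  (fun x : R => x ^+ 2)).
  exact: coord_continuous.
exact: exprn_continuous.
Qed.

Lemma mulmx_continuous m (B : 'M[R]_(m.+1, n.+1)) :
  continuous (fun x : 'rV[R]_m.+1 => x *m B).
Proof.
under eq_fun do rewrite mulmx_sum_row.
apply: (@continuous_big _ _ +%R 0 xpredT (@add_continuous 'rV[R]_n.+1) _ _
  (fun i (w : 'rV[R]_m.+1) => w ord0 i *: row i B)).
by move=> i _ w; apply: continuousZr_tmp; exact: coord_continuous.
Qed.

Lemma normalize_continuous v : v != 0 -> {for v, continuous normalize}.
Proof.
move=> v0; apply: continuousZ; last exact: cvg_id.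
apply: continuousV; first by rewrite gt_eqF// nrm_gt0.
exact: nrm_continuous.
Qed.

End Normalize.

(** * The sphere bounding a simplicial cone *)

Section Simplex.
Variable R : realType.
Implicit Types (x y : 'rV[R]_4) (z : 'rV[R]_3).

(** Applied to [x *m invmx A], the coefficients of x over the rows of A, its sign tells whether x is
    inside, on the boundary of, or outside the cone on these rows. *)
Definition min_coord x : R :=
  Num.min (Num.min (x 0 0) (x 0 1)) (Num.min (x 0 2%:R) (x 0 3%:R)).

Lemma ord4P (P : 'I_4 -> Prop) : P 0 -> P 1 -> P 2%:R -> P 3%:R -> forall i, P i.
Proof.
move=> p0 p1 p2 p3 [[|[|[|[|//]]]] i4].
- by rewrite (_ : Ordinal i4 = 0)//; apply/val_inj.
- by rewrite (_ : Ordinal i4 = 1)//; apply/val_inj.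
- by rewrite (_ : Ordinal i4 = 2%:R)//; apply/val_inj.
- by rewrite (_ : Ordinal i4 = 3%:R)//; apply/val_inj.
Qed.

Lemma le_min_coordP (a : R) x : reflect (forall i, a <= x 0 i) (a <= min_coord x).
Proof.
rewrite !le_min; apply: (iffP idP) => [|ax]; last by rewrite !ax.
by case/andP=> /andP[? ?] /andP[? ?]; apply: ord4P.
Qed.

Lemma lt_min_coordP (a : R) x : reflect (forall i, a < x 0 i) (a < min_coord x).
Proof.
rewrite !lt_min; apply: (iffP idP) => [|ax]; last by rewrite !ax.
by case/andP=> /andP[? ?] /andP[? ?]; apply: ord4P.
Qed.

Lemma min_coord_eq x : exists i, min_coord x = x 0 i.
Proof.
by rewrite /min_coord; case: leP => _; case: leP => _;
  [exists 0|exists 1|exists 2%:R|exists 3%:R|..]; eexists.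
Qed.

Lemma min_coord_continuous : continuous min_coord.
Proof.
have cc i : continuous (fun x : 'rV[R]_4 => x 0 i : R^o) by exact: coord_continuous.
move=> x.
apply: (@continuous_min _ _ (fun x => Num.min (x 0 0) (x 0 1))
  (fun x => Num.min (x 0 2%:R) (x 0 3%:R))).
  by apply: continuous_min; apply: cc.
by apply: continuous_min; apply: cc.
Qed.

Lemma min_coord_shift x a : min_coord (x + const_mx a) = min_coord x + a.
Proof. by rewrite /min_coord !mxE !addr_minl. Qed.

Lemma min_coordZ k x : 0 <= k -> min_coord (k *: x) = k * min_coord x.
Proof. by move=> k0; rewrite /min_coord !mxE !minr_pMr. Qed.

(* [cap] moves a vector of R^3 = R^4 / (1, 1, 1, 1) to the boundary of the positive
   orthant, [uncap] is the inverse projection. *)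
Definition uncap y : 'rV[R]_3 := \row_i (y 0 (lift 0 i) - y 0 0).
Definition ext z : 'rV[R]_4 := row_mx (0 : 'rV_1) z.
Definition cap z : 'rV[R]_4 := ext z - const_mx (min_coord (ext z)).

Lemma uncapZ k y : uncap (k *: y) = k *: uncap y.
Proof. by apply/rowP => i; rewrite !mxE mulrBr. Qed.

Lemma extE z : (ext z 0 0 = 0) * (forall i, ext z 0 (lift 0 i) = z 0 i).
Proof.
split=> [|i].
  have -> : ext z 0 0 = row_mx (0 : 'rV_1) z 0 (lshift 3 0).
    by congr (row_mx _ _ _ _); apply/val_inj.
  by rewrite row_mxEl mxE.
have -> : ext z 0 (lift 0 i) = row_mx (0 : 'rV_1) z 0 (rshift 1 i).
  by congr (row_mx _ _ _ _); apply/val_inj.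
by rewrite row_mxEr.
Qed.

(** [ext (uncap y)] differs from y by a multiple of (1, 1, 1, 1), and [cap] normalizes this multiple
    by making the minimum zero. *)
Lemma uncapK y : min_coord y = 0 -> cap (uncap y) = y.
Proof.
have -> : cap (uncap y) = y - const_mx (min_coord y).
  have e : ext (uncap y) = y + const_mx (- y 0 0).
    apply/rowP => j; rewrite [RHS]mxE [in RHS]mxE.
    by case: (unliftP 0 j) => [i ->|->]; rewrite extE ?mxE ?subrr.
  by rewrite /cap e min_coord_shift; apply/rowP => i; rewrite !mxE; ring.
by move=> ->; apply/rowP => i; rewrite !mxE subr0.
Qed.

Lemma capK z : uncap (cap z) = z.
Proof.
have capE j : cap z 0 j = ext z 0 j - min_coord (ext z).
  by rewrite [LHS]mxE; congr (_ + _); rewrite 2!mxE.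
by apply/rowP => i; rewrite [LHS]mxE !capE !extE; ring.
Qed.

Lemma min_coord_cap z : min_coord (cap z) = 0.
Proof.
rewrite /cap (_ : - const_mx _ = const_mx (- min_coord (ext z))).
  by rewrite min_coord_shift subrr.
by apply/rowP => i; rewrite !mxE.
Qed.

Lemma capZ k z : 0 <= k -> cap (k *: z) = k *: cap z.
Proof.
move=> k0; rewrite -[z in LHS]capK -uncapZ uncapK// min_coordZ// min_coord_cap mulr0//.
Qed.

Lemma cap_neq0 z : z != 0 -> cap z != 0.
Proof.
apply: contra_neq => z0; rewrite -(capK z) z0.
by apply/rowP => i; rewrite !mxE subrr.
Qed.

Lemma ext_continuous : continuous ext.
Proof.
have -> : ext = fun z => z *m (row_mx (0 : 'M[R]_(3, 1)) 1%:M : 'M[R]_(3, 4)).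
  apply/funext => z; have := mul_mx_row z (0 : 'M[R]_(3, 1)) 1%:M.
  by rewrite mulmx0 mulmx1 => /esym.
exact: mulmx_continuous.
Qed.

Lemma cap_continuous : continuous cap.
Proof.
have -> : cap = fun z => ext z - min_coord (ext z) *: const_mx 1.
  by apply/funext => z; congr (_ - _); apply/rowP => i; rewrite !mxE mulr1.
move=> z; apply: (@continuousB _ 'rV[R]_4 _ ext); first exact: ext_continuous.
apply: continuousZr_tmp; apply: (@continuous_comp _ _ _ ext).
  exact: ext_continuous.
exact: min_coord_continuous.
Qed.

Variable A : 'M[R]_4.
Hypothesis A_unit : A \in unitmx.

Definition simplex_boundary : set 'rV[R]_4 :=
  S3 R `&` [set x | min_coord (x *m invmx A) = 0].

Let mulA_neq0 x : x != 0 -> x *m A != 0.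
Proof. by apply: contra_neq => xA; rewrite -[x](mulmxK A_unit) xA mul0mx. Qed.

Lemma polyhedron_simplex_boundary : polyhedron simplex_boundary.
Proof.
(* The k-th matrix is A with row k replaced by 0; its cone is the facet opposite to that row. *)
exists [seq diag_mx (\row_j (j != k)%:R) *m A | k <- enum 'I_4].
apply/seteqP; split=> [x [x1 /= x0]|x].
  have [k xk] := min_coord_eq (x *m invmx A).
  exists (diag_mx (\row_j (j != k)%:R) *m A); first by apply: map_f; rewrite mem_enum.
  split=> //; exists (x *m invmx A); split; first by apply/le_min_coordP; rewrite x0.
  rewrite mulmxA -[LHS](mulmxKV A_unit); congr (_ *m _).
  apply/rowP => j; rewrite mul_mx_diag !mxE; case: eqVneq => [->|].
    by rewrite mulr0; move: xk; rewrite x0 mxE.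
  by rewrite mulr1.
case=> _ /mapP[k _ ->] [x1 [a [a0 xa]]]; split=> //=.
rewrite xa mulmxA mulmxK//; apply/le_anti/andP; split.
  have /le_min_coordP/(_ k) := lexx (min_coord (a *m diag_mx (\row_j (j != k)%:R))).
  by rewrite mul_mx_diag !mxE eqxx mulr0.
by apply/le_min_coordP => i; rewrite mul_mx_diag !mxE mulr_ge0.
Qed.

(** Through [cap] the unit sphere of R^3 parametrizes the rays of the boundary of the orthant, which
    A carries to those of the cone. As [cap] commutes with nonnegative scaling, rays correspond to
    rays, whence injectivity and surjectivity. *)
Lemma embedded_simplex_boundary : embedded_sphere simplex_boundary.
Proof.
split; first by move=> x [].
  exists id; split; last by rewrite image_id; exact: polyhedron_simplex_boundary.
  by exists id; split=> //; apply: continuous_subspaceT => x; exact: cvg_id.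
exists (fun z => normalize (cap z *m A)); split.
- apply: continuous_in_subspaceT => z /set_mem/usphere_neq0 z0.
  apply: (@continuous_comp _ _ _ (fun z => cap z *m A)).
    apply: (@continuous_comp _ _ _ cap (fun x => x *m A)); first exact: cap_continuous.
    exact: mulmx_continuous.
  by apply: normalize_continuous; rewrite mulA_neq0// cap_neq0.
- move=> z w /set_mem z1 /set_mem w1 /normalize_eq[||k k0].
  + by rewrite mulA_neq0// cap_neq0// usphere_neq0.
  + by rewrite mulA_neq0// cap_neq0// usphere_neq0.
  rewrite scalemxAl -capZ ?ltW// => /(can_inj (mulmxK A_unit))/(can_inj capK).
  exact: usphere_scale_inj.
- apply/seteqP; split=> [_ [z z1 <-]|x [x1 /= x0]].
    have z0 : cap z *m A != 0 by rewrite mulA_neq0// cap_neq0// usphere_neq0.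
    split; first exact: normalize_usphere.
    rewrite /= -scalemxAl mulmxK// min_coordZ ?invr_ge0 ?sqrtr_ge0//.
    by rewrite min_coord_cap mulr0.
  have u0 : uncap (x *m invmx A) != 0.
    apply: contraTneq (usphere_neq0 x1) => u0; rewrite negbK.
    rewrite -(mulmxKV A_unit x) -(uncapK x0) u0.
    by rewrite -(scale0r 0) capZ// scale0r mul0mx.
  exists (normalize (uncap (x *m invmx A))); first exact: normalize_usphere.
  rewrite capZ ?invr_ge0 ?sqrtr_ge0// -scalemxAl normalizeZ ?invr_gt0 ?nrm_gt0//.
  by rewrite uncapK// mulmxKV// normalize_id.
Qed.

(** By the intermediate value theorem, a connected set meeting both components contains a zero of
    [min_coord (w *m invmx A)], that is, a point of the sphere. *)
Lemma split_by_simplex n (L : 'I_n -> set 'rV[R]_4) i j :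
  (forall k, k = i \/ k = j) -> L i !=set0 -> L j !=set0 ->
  (forall k, L k `<=` S3 R) ->
  (forall x, L i x -> 0 < min_coord (x *m invmx A)) ->
  (forall x, L j x -> min_coord (x *m invmx A) < 0) -> split_link L.
Proof.
move=> ij [x Lx] [y Ly] LS Li Lj; exists simplex_boundary; split.
- exact: embedded_simplex_boundary.
- move=> k; apply/seteqP; split=> // w [[_ /= w0]].
  by case: (ij k) => ->; [move=> /Li|move=> /Lj]; rewrite w0 ltxx.
exists i, j, x, y; split=> // -[C [Cx CF cC] Cy].
have mc : continuous (fun w : 'rV[R]_4 => min_coord (w *m invmx A)).
  move=> w; apply: (@continuous_comp _ _ _ (fun w : 'rV[R]_4 => w *m invmx A)
    min_coord).
    exact: mulmx_continuous.
  exact: min_coord_continuous.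
have cm := continuous_subspaceT (A := C) mc.
have /connected_intervalP := connected_continuous_connected cC cm.
move=> /(_ _ _ (imageP _ Cy) (imageP _ Cx) 0).
rewrite (ltW (Li _ Lx)) (ltW (Lj _ Ly)) => /(_ isT)[w Cw w0].
by case: (CF w Cw) => w1; apply.
Qed.

End Simplex.

(** * Points on the twisted moment curve *)

Section Points.
Variable R : realType.

Definition pt (t : nat) : 'rV[R]_4 := \row_k ((-1) ^+ t * t%:R ^+ k).

Definition pairing (p : {poly R}) (v : 'rV[R]_4) : R := (v *m \col_k p`_k) 0 0.

Lemma pairingD p u v : pairing p (u + v) = pairing p u + pairing p v.
Proof. by rewrite /pairing mulmxDl mxE. Qed.

Lemma pairingZ p k v : pairing p (k *: v) = k * pairing p v.
Proof. by rewrite /pairing -scalemxAl mxE. Qed.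

Lemma pairing_sum p I (s : seq I) (F : I -> 'rV[R]_4) :
  pairing p (\sum_(i <- s) F i) = \sum_(i <- s) pairing p (F i).
Proof. by rewrite /pairing mulmx_suml summxE. Qed.

Lemma pairing_pt (p : {poly R}) t : (size p <= 4)%N ->
  pairing p (pt t) = (-1) ^+ t * p.[t%:R].
Proof.
move=> sp; rewrite /pairing mxE (horner_coef_wide _ sp) mulr_sumr.
by apply: eq_bigr => k _; rewrite !mxE -mulrA [_ * p`_k]mulrC.
Qed.

(** Pairing the relation with the polynomial whose roots are the other nodes, of degree at most 3,
    leaves only the term of i. *)
Lemma pt_free (I : seq nat) (a : nat -> R) : uniq I -> (size I <= 4)%N ->
  \sum_(i <- I) a i *: pt i = 0 -> forall i, i \in I -> a i = 0.
Proof.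
move=> uI sI a0 i iI; pose p : {poly R} := \prod_(j <- rem i I) ('X - j%:R%:P).
have pE : p = \prod_(x <- [seq j%:R | j <- rem i I]) ('X - x%:P) by rewrite big_map.
have sp : (size p <= 4)%N.
  by rewrite /p size_prod_XsubC size_rem// prednK//; case: (I) iI.
have : pairing p (\sum_(i <- I) a i *: pt i) = 0 by rewrite a0 /pairing mul0mx mxE.
rewrite pairing_sum (perm_big _ (perm_to_rem iI)) big_cons /= big_seq.
rewrite [X in _ + X]big1 => [|j jI]; last first.
  rewrite pairingZ pairing_pt// (_ : p.[_] = 0) ?mulr0//; apply/eqP.
  by rewrite -rootE pE root_prod_XsubC map_f.
rewrite addr0 pairingZ pairing_pt// => /eqP.
rewrite !mulf_eq0 signr_eq0 /= => /orP[/eqP//|].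
rewrite -rootE pE root_prod_XsubC => /mapP[j jI /eqP]; rewrite eqr_nat => /eqP ij.
by move: jI; rewrite -ij mem_rem_uniqF.
Qed.

Definition separator_poly (h : bool * seq nat) : {poly R} :=
  (-1) ^+ h.1 *: \prod_(r <- h.2) ('X - (r%:R + 2^-1)%:P).

Lemma size_separator_poly h : size (separator_poly h) = (size h.2).+1.
Proof. by rewrite size_scale ?signr_eq0// size_prod_XsubC. Qed.

(** The factor of a root r + 1/2 is negative at t exactly when t <= r, which [count (leq t)] counts;
    the other signs occur squared. *)
Lemma separator_poly_side h t : (size h.2 <= 3)%N ->
  0 < (-1) ^+ side h t * pairing (separator_poly h) (pt t).
Proof.
move=> sh; rewrite pairing_pt ?size_separator_poly// hornerZ.
rewrite /side !signr_addb signr_odd.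
have -> (u v w x : R) : u * v * w * (v * (u * x)) = u ^+ 2 * v ^+ 2 * (w * x) by ring.
rewrite !sqrr_sign !mul1r signr_odd.
elim: h.2 => [|r rs IH] /=; first by rewrite big_nil hornerC mulr1.
rewrite exprD big_cons hornerM hornerXsubC mulrACA mulr_gt0// {IH}.
case: leqP => tr; rewrite /= ?expr1 ?expr0.
  have : t%:R <= r%:R :> R by rewrite ler_nat.
  lra.
have : (r.+1)%:R <= t%:R :> R by rewrite ler_nat.
by rewrite -natr1; lra.
Qed.

Lemma separable_poly tri d : separable tri d -> exists p,
  [/\ forall t, t \in tri -> 0 < pairing p (pt t),
      pairing p (pt d.1) < 0 & pairing p (pt d.2) < 0].
Proof.
rewrite /separable; set h := separator _ _ => /and4P[sh /hasPn tri0 d1 d2].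
exists (separator_poly h); split=> [t /tri0/negbTE ht||].
- by have := separator_poly_side t sh; rewrite ht mul1r.
- by have := separator_poly_side d.1 sh; rewrite d1 mulN1r oppr_gt0.
- by have := separator_poly_side d.2 sh; rewrite d2 mulN1r oppr_gt0.
Qed.

(** * A thin tetrahedron around a triangle *)

Section ThinSimplex.
Variables a b c d : 'rV[R]_4.

(* The first three rows overshoot the triangle abc by s and lie s^2 beyond it in the
   direction -d; the last one lies 2s beyond it in the direction d. *)
Definition thin_rows (s : R) : seq 'rV[R]_4 :=
  [:: a - s *: (b + c) - s ^+ 2 *: d; b - s *: (c + a) - s ^+ 2 *: d;
      c - s *: (a + b) - s ^+ 2 *: d; a + b + c + (2 * s) *: d].

Definition thin_simplex (s : R) : 'M[R]_4 := \matrix_i nth 0 (thin_rows s) i.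

Lemma mul_thin_simplex s x : x *m thin_simplex s =
  x 0 0 *: (a - s *: (b + c) - s ^+ 2 *: d) +
  x 0 1 *: (b - s *: (c + a) - s ^+ 2 *: d) +
  x 0 2%:R *: (c - s *: (a + b) - s ^+ 2 *: d) +
  x 0 3%:R *: (a + b + c + (2 * s) *: d).
Proof.
rewrite mulmx_sum_row !big_ord_recl big_ord0 addr0 !rowK !addrA /=.
by congr (_ *: _ + _ *: _ + _ *: _ + _ *: _); congr (x _ _); apply/val_inj.
Qed.

Hypothesis free : forall k1 k2 k3 k4 : R,
  k1 *: a + k2 *: b + k3 *: c + k4 *: d = 0 -> [/\ k1 = 0, k2 = 0, k3 = 0 & k4 = 0].

(** Let S = x0 + x1 + x2 for a relation x between the rows. The coefficient of d gives 2 x3 = s S,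
    and the sum of the other three then gives (2 - s) S = 0. Hence x3 = 0, and each remaining
    equation reads (1 + s) xi = 0. *)
Lemma thin_simplex_unit s : 0 < s < 1 -> thin_simplex s \in unitmx.
Proof.
move=> /andP[s0 s1]; rewrite -row_free_unit; apply: inj_row_free => x.
rewrite mul_thin_simplex; set x0 := x 0 0; set x1 := x 0 1.
set x2 := x 0 2%:R; set x3 := x 0 3%:R.
move=> xA.
have [] := @free (x0 - s * (x1 + x2) + x3) (x1 - s * (x2 + x0) + x3)
  (x2 - s * (x0 + x1) + x3) (2 * s * x3 - s ^+ 2 * (x0 + x1 + x2)).
  by rewrite -[RHS]xA; apply/rowP => i; rewrite !mxE; ring.
move=> e0 e1 e2 e3.
have e4 : 2 * x3 = s * (x0 + x1 + x2).
  by apply: (mulfI (lt0r_neq0 s0)); lra.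
have e5 : (2 - s) * (x0 + x1 + x2) = 0 by lra.
have e6 : x0 + x1 + x2 = 0.
  by apply/eqP; move/eqP: e5; rewrite mulf_eq0 => /orP[/eqP|//]; lra.
have e7 : x3 = 0 by move: e4; rewrite e6; lra.
have z k : k - s * (- k) + x3 = 0 -> k = 0.
  rewrite e7 => h; apply/eqP; have /eqP : (1 + s) * k = 0 by lra.
  by rewrite mulf_eq0 => /orP[/eqP|//]; lra.
apply/rowP; apply: ord4P; rewrite mxE; [apply: z|apply: z|apply: z|exact: e7].
- by rewrite -/x0 -[RHS]e0 (_ : - x0 = x1 + x2)//; lra.
- by rewrite -/x1 -[RHS]e1 (_ : - x1 = x2 + x0)//; lra.
- by rewrite -/x2 -[RHS]e2 (_ : - x2 = x0 + x1)//; lra.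
Qed.

Lemma thin_simplex_inner s : 0 < s < 1 -> forall x, x \in [:: a; b; c] ->
  0 < min_coord (x *m invmx (thin_simplex s)).
Proof.
move=> s01 x xabc; have u := thin_simplex_unit s01; case/andP: s01 => s0 s1.
(* This value makes the coefficient of d cancel in [coef k1 k2 k3 *m thin_simplex s]. *)
pose w := s / (2 - s).
have w0 : 0 < w by rewrite divr_gt0//; lra.
pose coef k1 k2 k3 : 'rV[R]_4 :=
  (1 + s)^-1 *: \row_i nth 0 [:: k1 + w; k2 + w; k3 + w; (1 + s) * w] i.
have coefE k1 k2 k3 : k1 + k2 + k3 = 1 ->
    coef k1 k2 k3 *m thin_simplex s = k1 *: a + k2 *: b + k3 *: c.
  move=> k; rewrite -scalemxAl mul_thin_simplex; apply/rowP => i.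
  rewrite !mxE /= /w (_ : k1 = 1 - k2 - k3); last by lra.
  by field; lra.
have inner k1 k2 k3 : 0 <= k1 -> 0 <= k2 -> 0 <= k3 -> k1 + k2 + k3 = 1 ->
  0 < min_coord ((k1 *: a + k2 *: b + k3 *: c) *m invmx (thin_simplex s)).
  move=> k10 k20 k30 k; rewrite -coefE// mulmxK// min_coordZ ?invr_ge0//; last by lra.
  rewrite mulr_gt0 ?invr_gt0//; first by lra.
  apply/lt_min_coordP; apply: ord4P; rewrite mxE /= ?ltr_wpDl// pmulr_lgt0//; lra.
move: xabc; rewrite !inE => /or3P[] /eqP->.
- have := inner 1 0 0; rewrite !scale0r scale1r !(addr0, add0r) => H; apply: H; lra.
- have := inner 0 1 0; rewrite !scale0r scale1r !(addr0, add0r) => H; apply: H; lra.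
- have := inner 0 0 1; rewrite !scale0r scale1r !(addr0, add0r) => H; apply: H; lra.
Qed.

(** As s tends to 0 the rows tend to a, b, c and a + b + c, where p is positive. *)
Lemma thin_simplex_outer p : 0 < pairing p a -> 0 < pairing p b -> 0 < pairing p c ->
  exists2 m : R, 0 < m & forall s, 0 < s -> s <= m ->
   all (fun v => 0 <= pairing p v) (thin_rows s).
Proof.
have pairingB u v k : pairing p (u - k *: v) = pairing p u - k * pairing p v.
  by rewrite -scaleNr pairingD pairingZ mulNr.
rewrite /= => x0 y0 z0;
(* For s <= 1, s * S bounds whatever the terms in s can take away from the value of p on any row. *)
set S := pairing p a + pairing p b + pairing p c + 2 * `|pairing p d|.
pose m := Num.min (pairing p a) (Num.min (pairing p b) (pairing p c)).
have m0 : 0 < m by rewrite !lt_min x0 y0 z0.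
have S0 : 0 < S by rewrite /S; have := normr_ge0 (pairing p d); lra.
exists (Num.min 1 (m / S)) => [|s s0]; first by rewrite lt_min ltr01 divr_gt0.
rewrite le_min ler_pdivlMr// => /andP[s1 sm].
rewrite /thin_rows /= !pairingB !pairingD pairingZ andbT.
have [xm ym zm] : [/\ m <= pairing p a, m <= pairing p b & m <= pairing p c].
  by rewrite /m !ge_min !lexx !orbT.
have td : s ^+ 2 * pairing p d <= s * `|pairing p d|.
  rewrite expr2 -mulrA ler_pM2l//; apply: le_trans (ler_norm _) _.
  by rewrite normrM (gtr0_norm s0) ler_piMl.
have td' : - (s * `|pairing p d|) <= s * pairing p d.
  by rewrite lerNl -mulrN ler_pM2l// -normrN ler_norm.
move: sm; rewrite /S !mulrDr !mulrA.
have := mulr_gt0 s0 x0; have := mulr_gt0 s0 y0; have := mulr_gt0 s0 z0.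
have := mulr_ge0 (ltW s0) (normr_ge0 (pairing p d)).
by move=> *; apply/and4P; split; lra.
Qed.

End ThinSimplex.

(** Each edge of [ds] has its own polynomial p, and one small s serves them all. A point of the edge
    inside the closed cone would have p >= 0, as p is nonnegative on the rows, whereas p < 0 on the
    edge. The point l only completes a basis. *)
Lemma separating_simplex i j k l ds : uniq [:: i; j; k; l] ->
  all (separable [:: i; j; k]) ds -> exists A : 'M[R]_4,
  [/\ A \in unitmx, forall t, t \in [:: i; j; k] -> 0 < min_coord (pt t *m invmx A) &
    forall d, d \in ds -> forall x y, 0 <= x -> 0 <= y -> 0 < x + y ->
      min_coord ((x *: pt d.1 + y *: pt d.2) *m invmx A) < 0].
Proof.
move=> u sep; pose row s := thin_rows (pt i) (pt j) (pt k) (pt l) s.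
have [m m0 mP] : exists2 m : R, 0 < m & forall s, 0 < s -> s <= m -> forall d,
    d \in ds -> exists p, [/\ pairing p (pt d.1) < 0, pairing p (pt d.2) < 0 &
      all (fun v => 0 <= pairing p v) (row s)].
  elim: ds sep => [|d ds IH] /=; first by exists 1.
  case/andP=> /separable_poly[p [pi pd1 pd2]] /IH[m m0 mP].
  have [||| m' m'0 mP'] := @thin_simplex_outer (pt i) (pt j) (pt k) (pt l) p.
  - by apply: pi; rewrite !inE eqxx.
  - by apply: pi; rewrite !inE eqxx orbT.
  - by apply: pi; rewrite !inE eqxx !orbT.
  exists (Num.min m m') => [|s s0]; first by rewrite lt_min m0.
  rewrite le_min => /andP[sm sm'] d'; rewrite inE => /orP[/eqP->|]; last exact: mP.
  by exists p; split=> //; exact: mP'.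
pose s := Num.min m 2^-1.
have s01 : 0 < s < 1.
  by rewrite lt_min m0 invr_gt0 ltr0n /= gt_min [2^-1 < 1]invf_lt1 ?ltr1n ?orbT.
have free k1 k2 k3 k4 :
    k1 *: pt i + k2 *: pt j + k3 *: pt k + k4 *: pt l = 0 ->
    [/\ k1 = 0, k2 = 0, k3 = 0 & k4 = 0].
  move=> z; pose a (t : nat) : R := if t == i then k1 else if t == j then k2 else
    if t == k then k3 else k4.
  move: (u); rewrite /= !inE !negb_or => /and4P[/and3P[ij ik il] /andP[jk jl] kl _].
  have [ai aj ak al] : [/\ a i = k1, a j = k2, a k = k3 & a l = k4].
    rewrite /a !eqxx [j == i]eq_sym [k == i]eq_sym [l == i]eq_sym [k == j]eq_sym.
    rewrite [l == j]eq_sym [l == k]eq_sym.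
    by rewrite (negbTE ij) (negbTE ik) (negbTE il) (negbTE jk) (negbTE jl) (negbTE kl).
  have /(pt_free u isT) a0 : \sum_(t <- [:: i; j; k; l]) a t *: pt t = 0.
    by rewrite !big_cons big_nil ai aj ak al addr0 !addrA.
  by rewrite -ai -aj -ak -al; split; apply: a0; rewrite !inE eqxx ?orbT.
pose A := thin_simplex (pt i) (pt j) (pt k) (pt l) s.
have A_unit := thin_simplex_unit free s01.
exists A; split=> // [t tI|d dI x y x0 y0 xy].
  apply: thin_simplex_inner => //; move: tI; rewrite !inE.
  by case/or3P=> /eqP->; rewrite eqxx ?orbT.
have s0 : 0 < s by case/andP: s01.
have sm : s <= m by rewrite ge_min lexx.
have [p [p1 p2 /all_nthP pA]] := mP s s0 sm d dI.
rewrite ltNge; apply/negP => /le_min_coordP c0.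
have : pairing p (x *: pt d.1 + y *: pt d.2) < 0.
  rewrite pairingD !pairingZ; have [x'|x'] := eqVneq x 0.
    by rewrite x' mul0r add0r pmulr_rlt0//; lra.
  apply: ltr_wnDr; first by rewrite mulr_ge0_le0// ltW.
  by rewrite pmulr_rlt0// lt_neqAle eq_sym x'.
apply/negP; rewrite -leNgt.
rewrite -(mulmxKV A_unit (_ + _)) mulmx_sum_row pairing_sum.
by apply: sumr_ge0 => h _; rewrite pairingZ mulr_ge0// rowK; apply: pA; exact: ltn_ord.
Qed.

End Points.

(** * The embedding *)

Section CycleImage.
Variables (R : realType) (V : finType) (e : rel V) (G : graph_embedding R e).

Lemma cycle_image_rot n c : uniq c -> cycle_image G (rot n c) = cycle_image G c.
Proof.
move=> uc; rewrite /cycle_image; congr (\bigcup_(p in _) _).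
by apply/funext => p /=; rewrite !mem_rot !next_rot.
Qed.

Lemma cycle_image_rev c : uniq c -> cycle_image G (rev c) = cycle_image G c.
Proof.
move=> uc; rewrite /cycle_image; congr (\bigcup_(p in _) _).
apply/funext => p /=; rewrite !mem_rev !next_rev//.
have E u v : (u == prev c v) = (v == next c u).
  by apply/eqP/eqP => ->; [rewrite next_prev|rewrite prev_next].
by rewrite !E orbC.
Qed.

Lemma cycle_image_S3 c : cycle_image G c `<=` S3 R.
Proof. by move=> x [p [pe _ _ _] [t t01 <-]]; exact: arc_S3. Qed.

Lemma cycle_image_neq0 c : c != [::] -> cycle e c -> cycle_image G c !=set0.
Proof.
case: c => // u c _ ce; exists (edge_arc G u (next (u :: c) u) 0).
exists (u, next (u :: c) u); last by exists 0 => //; rewrite /= in_itv /= lexx ler01.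
have uc : u \in u :: c by rewrite inE eqxx.
by split; rewrite ?mem_next ?eqxx// next_cycle.
Qed.

End CycleImage.

Lemma next_edges (T : eqType) (c : seq T) u : u \in c -> (u, next c u) \in edges c.
Proof.
move=> uc; have sz : size c = size (rot 1 c) by rewrite size_rot.
have -> : (u, next c u) = nth (u, u) (edges c) (index u c).
  rewrite nth_zip// nth_index// next_nth uc; congr (_, _).
  case: c uc {sz} => // v c uc; rewrite rot1_cons nth_rcons.
  have : (index u (v :: c) < (size c).+1)%N.
    by rewrite -[X in (_ < X)%N]/(size (v :: c)) index_mem.
  (* At the last index [next] falls back on the default, the head of the cycle, which [rot 1] has
     moved to the end. *)
  move: (index u (v :: c)) => i; rewrite ltnS leq_eqVlt => /orP[/eqP->|ic].
    by rewrite ltnn eqxx nth_default.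
  by rewrite ic; exact: set_nth_default.
by rewrite mem_nth// size_zip -sz minnn index_mem.
Qed.

Lemma mem_edges (T : eqType) (c : seq T) d :
  d \in edges c -> d.1 \in c /\ d.2 \in c.
Proof.
move=> dc; have sz : size (rot 1 c) = size c by rewrite size_rot.
split; last rewrite -(mem_rot 1).
  by have := map_f fst dc; rewrite -/(unzip1 _) unzip1_zip// sz.
by have := map_f snd dc; rewrite -/(unzip2 _) unzip2_zip// sz.
Qed.

Section Embedding.
Variables (R : realType) (V : finType) (e : rel V).
Hypothesis irr : forall u, ~~ e u u.
Hypothesis tour : forall u v, u != v -> e u v (+) e v u.
Variable s : seq V.
Hypothesis ms : s =i V.

Definition ray (v : V) : 'rV[R]_4 := pt R (index v s).
Definition chord (u v : V) (t : R) : 'rV[R]_4 := (1 - t) *: ray u + t *: ray v.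
(** The coefficient of [ray w] in [chord u v t]; equalities between points of arcs are turned into
    equalities of weights. *)
Definition weight (u v : V) (t : R) (w : V) : R :=
  (1 - t) * (w == u)%:R + t * (w == v)%:R.

Lemma ray_free (I : seq V) (a : V -> R) : uniq I -> (size I <= 4)%N ->
  \sum_(v <- I) a v *: ray v = 0 -> forall v, v \in I -> a v = 0.
Proof.
move=> uI sI a0 v vI; pose b i := a (nth v s i).
have idx w : nth v s (index w s) = w by rewrite nth_index// ms.
have : b (index v s) = 0.
  apply: (@pt_free R (map (index^~ s) I)); rewrite ?size_map//.
  - by rewrite map_inj_in_uniq// => w w' _ _ /(congr1 (nth v s)); rewrite /= !idx.
  - by rewrite big_map -[RHS]a0; apply: eq_bigr => w _; rewrite /b idx.
  - exact: (map_f (index^~ s)).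
by rewrite /b idx => ->.
Qed.

Lemma sum_weight (I : seq V) u v t : uniq I -> u \in I -> v \in I ->
  \sum_(w <- I) weight u v t w = 1.
Proof.
have delta x : uniq I -> x \in I -> \sum_(w <- I) (w == x)%:R = 1 :> R.
  move=> uI xI; rewrite (bigD1_seq x)//= eqxx big1 ?addr0// => w /negbTE->//.
by move=> uI uI' vI; rewrite big_split -!mulr_sumr /= !delta//; ring.
Qed.

Lemma chord_weight (I : seq V) u v t : uniq I -> u \in I -> v \in I ->
  chord u v t = \sum_(w <- I) weight u v t w *: ray w.
Proof.
have delta x : uniq I -> x \in I -> \sum_(w <- I) (w == x)%:R *: ray w = ray x.
  move=> uI xI; rewrite (bigD1_seq x)//= eqxx scale1r big1 ?addr0// => w /negbTE->.
  by rewrite scale0r.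
move=> uI uI' vI; under eq_bigr do rewrite scalerDl -!scalerA.
by rewrite big_split -!scaler_sumr /= !delta.
Qed.

(** At most four rays occur and they are independent, so the weights agree up to the factor k; both
    families sum to 1, which forces k = 1. *)
Lemma chord_inj k u v t u' v' t' : chord u v t = k *: chord u' v' t' ->
  k = 1 /\ weight u v t =1 weight u' v' t'.
Proof.
move=> st; pose I := undup [:: u; v; u'; v'].
have uI : uniq I := undup_uniq _.
have [mu mv mu' mv'] : [/\ u \in I, v \in I, u' \in I & v' \in I].
  by rewrite !mem_undup !inE !eqxx !orbT.
have I0 w : w \in I -> weight u v t w = k * weight u' v' t' w.
  move=> wI; apply/eqP; rewrite -subr_eq0; apply/eqP.
  apply: (@ray_free I (fun w => weight u v t w - k * weight u' v' t' w)) => //.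
    exact: size_undup.
  under eq_bigr do rewrite scalerBl -scalerA.
  by rewrite sumrB -scaler_sumr -!chord_weight// st subrr.
have k1 : k = 1.
  rewrite -(sum_weight t uI mu mv) -[LHS]mulr1 -(sum_weight t' uI mu' mv') mulr_sumr.
  by rewrite big_seq [RHS]big_seq; apply: eq_bigr => w /I0.
split=> // w; have [/I0|] := boolP (w \in I); first by rewrite k1 mul1r.
rewrite mem_undup !inE !negb_or => /and4P[a b c d].
by rewrite /weight (negbTE a) (negbTE b) (negbTE c) (negbTE d) !mulr0.
Qed.

(** A zero chord would be 0 times itself, against k = 1 in [chord_inj]. *)
Lemma chord_neq0 u v t : chord u v t != 0.
Proof.
apply/eqP => s0; have [|/esym/eqP] := @chord_inj 0 u v t u v t.
  by rewrite scale0r.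
by rewrite oner_eq0.
Qed.

Lemma chord_refl u t : chord u u t = ray u.
Proof. by rewrite /chord -scalerDl subrK scale1r. Qed.

Lemma normalize_chord u v t u' v' t' :
  normalize (chord u v t) = normalize (chord u' v' t') ->
  weight u v t =1 weight u' v' t'.
Proof.
by move=> /normalize_eq[||k _ /chord_inj[]//]; exact: chord_neq0.
Qed.

Lemma ray_inj : injective (fun v => normalize (ray v)).
Proof.
move=> u v; rewrite -(chord_refl u 0) -(chord_refl v 0) => /normalize_chord/(_ u).
rewrite /weight eqxx; case: eqVneq => // _ /eqP.
by rewrite !mulr0 !mulr1 subrK addr0 oner_eq0.
Qed.

Let Vtx v := normalize (ray v).
Let Arc u v t := normalize (chord u v t).

Let Vtx_S3 v : S3 R (Vtx v).
Proof. by apply: normalize_usphere; rewrite -(chord_refl v 0) chord_neq0. Qed.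

Let Arc_S3 u v : e u v -> set_fun `[0, 1] (S3 R) (Arc u v).
Proof. by move=> _ t _; apply: normalize_usphere; exact: chord_neq0. Qed.

Let Arc_continuous u v : e u v -> {within `[0, 1], continuous (Arc u v)}.
Proof.
move=> _; apply: continuous_subspaceT => t.
apply: (@continuous_comp _ _ _ (chord u v) (@normalize R 3)); last first.
  by apply: normalize_continuous; exact: chord_neq0.
apply: (@continuousD R 'rV[R]_4 R^o (fun t : R^o => (1 - t) *: ray u)
  (fun t : R^o => t *: ray v)).
  apply: continuousZr_tmp; apply: (@continuousB R R^o R^o (cst 1) id);
    last exact: cvg_id.
  exact: cvg_cst.
by apply: continuousZr_tmp; exact: cvg_id.
Qed.

Let Arc_ends u v : e u v -> Arc u v 0 = Vtx u /\ Arc u v 1 = Vtx v.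
Proof.
by move=> _; rewrite /Arc /chord subr0 subrr !scale1r !scale0r addr0 add0r.
Qed.

Let e_neq u v : e u v -> u != v.
Proof. by move=> uv; apply: contraTneq uv => ->. Qed.

Let Arc_vtx u v w (t : R) : e u v -> t \in `]0, 1[ -> Arc u v t <> Vtx w.
Proof.
move=> /e_neq uv; rewrite in_itv /= => /andP[t0 t1].
rewrite /Arc /Vtx -(chord_refl w 0) => /normalize_chord/(_ u).
rewrite /weight eqxx (negbTE uv) subr0 !mul1r mul0r mulr0 mulr1 !addr0.
by case: eqVneq => _ /=; lra.
Qed.

(** The weights at u and v are 1 - t and t, both positive, so the two arcs have the same ends; if
    swapped, they would be opposite edges, excluded by [tour]. *)
Let Arc_inj u v u' v' (t t' : R) : e u v -> e u' v' ->
  t \in `]0, 1[ -> t' \in `]0, 1[ -> Arc u v t = Arc u' v' t' ->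
  (u, v, t) = (u', v', t').
Proof.
move=> uv u'v'; have uvn := e_neq uv; have u'v'n := e_neq u'v'.
rewrite !in_itv /= => /andP[t0 t1] /andP[t'0 t'1] /normalize_chord W.
have := W v; have := W u; rewrite /weight !eqxx [v == u]eq_sym (negbTE uvn).
case: (eqVneq u u') => [uu'|_].
  subst u'; rewrite [v == u]eq_sym (negbTE uvn) (negbTE u'v'n) => _.
  case: (eqVneq v v') => [<- /= tt'|_ /= h]; last by exfalso; lra.
  by congr (_, _, _); lra.
case: (eqVneq u v') => [uv'|_ /= h]; last by exfalso; lra.
subst v'; rewrite [v == u]eq_sym (negbTE uvn) => _.
case: (eqVneq v u') => [vu'|_ /= h]; last by exfalso; lra.
by subst u'; have := tour uvn; rewrite uv u'v'.
Qed.

Definition great_embedding : graph_embedding R e :=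
  @GraphEmbedding R V e Vtx Arc Vtx_S3 ray_inj Arc_S3 Arc_continuous Arc_ends
    Arc_vtx Arc_inj.

Lemma tame_great_embedding : tame (graph_image great_embedding).
Proof.
exists id; rewrite image_id; split.
  by exists id; split=> //; apply: continuous_subspaceT => x; exact: cvg_id.
(* The default 0 of [nth] fills the last two rows, so the simplex is an arc, or a single point for
   [piece v v]. *)
pose piece u v : 'M[R]_4 := \matrix_i nth 0 [:: ray u; ray v] i.
have pieceE u v (x : 'rV_4) : x *m piece u v = x 0 0 *: ray u + x 0 1 *: ray v.
  rewrite mulmx_sum_row !big_ord_recl big_ord0 addr0 !rowK /= !scaler0 !addr0.
  by congr (_ *: _ + x _ _ *: _); apply/val_inj.
have chord_piece u v t : 0 <= t <= 1 -> spherical_simplex (piece u v) (Arc u v t).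
  move=> /andP[t0 t1]; split; first by apply: normalize_usphere; exact: chord_neq0.
  pose k := (nrm (chord u v t))^-1.
  have k0 : 0 <= k by rewrite invr_ge0 sqrtr_ge0.
  exists (k *: \row_i nth 0 [:: 1 - t; t] i); split.
    by apply: ord4P; rewrite !mxE mulr_ge0//= subr_ge0.
  by rewrite -scalemxAl pieceE !mxE.
exists [seq piece z.1 z.2 | z <- enum {: V * V} & (z.1 == z.2) || e z.1 z.2].
apply/seteqP; split=> [x [[v _ <-]|[[u v] /= uv [t t01 <-]]]|x].
- exists (piece v v); last first.
    by rewrite /= /Vtx -(chord_refl v 0); apply: chord_piece; rewrite lexx ler01.
  by apply: (map_f (fun z : V * V => piece z.1 z.2) (x := (v, v)));
    rewrite mem_filter mem_enum /= eqxx.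
- exists (piece u v); last by apply: chord_piece; move: t01; rewrite /= in_itv.
  by apply: (map_f (fun z : V * V => piece z.1 z.2) (x := (u, v)));
    rewrite mem_filter mem_enum /= uv orbT.
case=> _ /mapP[[u v] + ->]; rewrite mem_filter mem_enum andbT /= => uv.
case=> x1 [a [a0 xa]]; move: xa; rewrite pieceE => xa.
pose k := a 0 0 + a 0 1; pose t := a 0 1 / k.
have k0 : 0 < k.
  rewrite lt_neqAle addr_ge0// andbT; apply: contraTneq (usphere_neq0 x1) => /esym/eqP.
  rewrite paddr_eq0// => /andP[/eqP b0 /eqP b1].
  by rewrite xa b0 b1 !scale0r addr0 eqxx.
have xs : x = k *: chord u v t.
  rewrite xa /chord scalerDr !scalerA mulrBr mulr1 /t mulrCA divff ?gt_eqF// mulr1.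
  by rewrite /k addrK.
have {}xs : x = Arc u v t by rewrite -(normalize_id x1) xs normalizeZ.
case/orP: uv => [/eqP uv|uv].
  by left; exists v => //; rewrite xs uv /Arc chord_refl.
right; exists (u, v) => //; exists t => //; rewrite /= in_itv /=.
by rewrite /t divr_ge0 ?(ltW k0)//= ler_pdivrMr// mul1r lerDr.
Qed.

Lemma cycle_image_great c x : uniq c -> cycle_image great_embedding c x ->
  exists d : V * V, d \in edges c /\ exists k l : R,
   [/\ 0 <= k, 0 <= l, 0 < k + l & x = k *: ray d.1 + l *: ray d.2].
Proof.
move=> uc [[u v] /= [uv mu mv nx] [t /= t01 <-]].
move: t01; rewrite in_itv /= => /andP[t0 t1].
have n0 : 0 < (nrm (chord u v t))^-1 by rewrite invr_gt0 nrm_gt0// chord_neq0.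
case/orP: nx => /eqP nx.
  exists (u, v); split; first by rewrite nx next_edges.
  exists ((nrm (chord u v t))^-1 * (1 - t)), ((nrm (chord u v t))^-1 * t); split.
  - by rewrite mulr_ge0 ?subr_ge0// ltW.
  - by rewrite mulr_ge0// ltW.
  - by rewrite -mulrDr subrK mulr1.
  - by rewrite -!scalerA -scalerDr.
exists (v, u); split; first by rewrite nx next_edges.
exists ((nrm (chord u v t))^-1 * t), ((nrm (chord u v t))^-1 * (1 - t)); split.
- by rewrite mulr_ge0// ltW.
- by rewrite mulr_ge0 ?subr_ge0// ltW.
- by rewrite -mulrDr addrC subrK mulr1.
- by rewrite -!scalerA -scalerDr addrC.
Qed.

Lemma split_avoiding n (c : 'I_n -> seq V) i j :
  (forall k, k = i \/ k = j) -> (forall k, uniq (c k)) -> (forall k, cycle e (c k)) ->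
  size (c i) = 3 -> c j != [::] -> [disjoint c i & c j]%bool ->
  avoids (map (index^~ s) (c i)) (map (index^~ s) (c j)) ->
  split_link (fun k => cycle_image great_embedding (c k)).
Proof.
move=> ij uc ec ci3 cj0 dij; rewrite /avoids edges_map => sep.
(* By disjointness w is off the triangle, so it can serve as the fourth point of
   [separating_simplex]. *)
have [w wj] : exists w, w \in c j.
  by case: (c j) cj0 => // w ? _; exists w; rewrite inE eqxx.
have wi : w \notin c i by apply/negP => /(disjointFr dij); rewrite wj.
have [A [A_unit inA outA]] : exists A : 'M[R]_4, [/\ A \in unitmx,
    forall v, v \in c i -> 0 < min_coord (ray v *m invmx A) &
    forall d : V * V, d \in edges (c j) -> forall x y, 0 <= x -> 0 <= y -> 0 < x + y ->
      min_coord ((x *: ray d.1 + y *: ray d.2) *m invmx A) < 0].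
  case ci: (c i) ci3 sep wi (uc i) => [|u1 [|u2 [|u3 []]]]// _ sep wi uci.
  have uI : uniq (map (index^~ s) (rcons (c i) w)).
    rewrite map_inj_uniq ?rcons_uniq ?ci ?wi//.
    by move=> u v /(congr1 (nth w s)); rewrite /= !nth_index ?ms.
  rewrite ci in uI; have [A [A_unit inA outA]] := separating_simplex R uI sep.
  exists A; split=> // [v vi|d dj]; first by apply: inA; exact: (map_f (index^~ s) vi).
  exact: (outA _ (map_f (fun d : V * V => (index d.1 s, index d.2 s)) dj)).
apply: (@split_by_simplex R A A_unit n _ i j) => //.
- by apply: cycle_image_neq0 => //; case: (c i) ci3.
- exact: cycle_image_neq0.
- by move=> k; exact: cycle_image_S3.
(* The open cone is convex, so it contains the edges of the triangle along with its vertices. *)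
- move=> x /(cycle_image_great (uc i))[d [dI [k [l [k0 l0 kl ->]]]]].
  have [/inA/lt_min_coordP d1 /inA/lt_min_coordP d2] := mem_edges dI.
  apply/lt_min_coordP => h; rewrite mulmxDl -!scalemxAl !mxE; move: (d1 h) (d2 h).
  rewrite !mxE => d1h d2h; have [k'|k'] := eqVneq k 0.
    by rewrite k' mul0r add0r mulr_gt0//; lra.
  by rewrite ltr_pwDl ?mulr_ge0 ?mulr_gt0 ?(ltW d2h)// lt_neqAle eq_sym k'.
- move=> x /(cycle_image_great (uc j))[d [dI [k [l [k0 l0 kl ->]]]]].
  exact: outA.
Qed.

End Embedding.

(** * Normalizing the cycles and concluding *)

(** The cycle is reversed if necessary to follow the arcs, then rotated to start where f is least;
    neither changes its image. *)
Lemma consistent_cycle (R : realType) (V : finType) (e : rel V)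
    (G : graph_embedding R e) (f : V -> nat) c :
  graph_cycle e c -> consistently_oriented e c ->
  exists c', [/\ c' =i c, uniq c' /\ cycle e c', (2 < size c')%N,
    all (leq (head 0 (map f c'))) (map f c') & cycle_image G c' = cycle_image G c].
Proof.
move=> /and3P[sc uc _] oc.
have [c1 [c1c uc1 ec1 sc1 Gc1]] : exists c1, [/\ c1 =i c, uniq c1, cycle e c1,
    (2 < size c1)%N & cycle_image G c1 = cycle_image G c].
  case/orP: oc => oc; first by exists c.
  exists (rev c); rewrite rev_uniq size_rev cycle_image_rev//.
  by split=> // x; rewrite mem_rev.
have [v0 v0c] : exists v, v \in c1.
  by case: (c1) sc1 => // v ? _; exists v; rewrite inE eqxx.
have [v vc vmin] := arg_minnP f v0c.
have [k c' c'E] := rot_to vc.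
exists (rot k c1); rewrite rot_uniq rot_cycle size_rot cycle_image_rot//.
split=> //; first by move=> x; rewrite mem_rot.
rewrite c'E /= leqnn; apply/allP => _ /mapP[x xc ->].
have : x \in c1 by rewrite -(mem_rot k) c'E inE xc orbT.
exact: vmin.
Qed.

Local Close Scope ring_scope.
Local Close Scope classical_set_scope.

Theorem theorem2p2 (R : realType) (V : finType) (e : rel V) (hV : #|V| = 7)
    (he : tournament e) : ~ intrinsically_linked_digraph R e.
Proof.
case: he => irr tour; have [s [us ms s7 nolink]] := placement irr tour hV.
move=> /(_ _ (tame_great_embedding R irr tour ms)).
set G := great_embedding _ _ _ _; case=> n [c [n1 cyc dis]]; apply.
have /choice[c' c'P] : forall i, exists c', [/\ c' =i c i, uniq c' /\ cycle e c',
    (2 < size c')%N, all (leq (head 0 (map (index^~ s) c'))) (map (index^~ s) c') &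
    cycle_image G c' = cycle_image G (c i)].
  by move=> i; have [ci oi] := cyc i; exact: consistent_cycle.
have -> : (fun i => cycle_image G (c i)) = fun i => cycle_image G (c' i).
  by apply/funext => i; have [_ _ _ _ ->] := c'P i.
have uc' i : uniq (c' i) by have [_ []] := c'P i.
have ec' i : cycle e (c' i) by have [_ []] := c'P i.
have sc' i : (2 < size (c' i))%N by have [] := c'P i.
have dis' i j : i != j -> [disjoint c' i & c' j]%bool.
  move=> /dis; have [ci _ _ _ _] := c'P i; have [cj _ _ _ _] := c'P j.
  by rewrite (eq_disjoint ci) (eq_disjoint_r cj).
have le7 (l : seq V) : uniq l -> (size l <= 7)%N.
  by move=> ul; rewrite -hV -(card_uniqP ul); exact: max_card.
have ucat i j : i != j -> uniq (c' i ++ c' j).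
  move=> ij; rewrite cat_uniq !uc' andbT /= -disjoint_has disjoint_sym.
  exact: dis'.
have sizes a b : 2 < a -> 2 < b -> a + b <= 7 ->
    [\/ a = 3 /\ b = 3, a = 3 /\ b = 4 | a = 4 /\ b = 3].
  move=> a2 b2 ab; have : [|| (a == 3) && (b == 3), (a == 3) && (b == 4) |
    (a == 4) && (b == 3)] by lia.
  by case/or3P => /andP[/eqP-> /eqP->]; [constructor 1|constructor 2|constructor 3].
pose i : 'I_n := Ordinal (ltnW n1); pose j : 'I_n := Ordinal n1.
have ij : i != j by [].
(* A third cycle would bring the number of vertices to at least nine. *)
have two k : k = i \/ k = j.
  have [->|ki] := eqVneq k i; first by left.
  have [->|kj] := eqVneq k j; first by right.
  have := le7 (c' k ++ c' i ++ c' j); rewrite cat_uniq uc' ucat// has_cat !size_cat.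
  rewrite negb_or -!disjoint_has.
  rewrite ![[disjoint _ & c' k]%bool]disjoint_sym !dis'// => /(_ isT) sz.
  by have := leq_trans (leq_add (sc' k) (leq_add (sc' i) (sc' j))) sz.
have two' k : k = j \/ k = i by case: (two k); [right|left].
have ji : j != i by rewrite eq_sym.
have split_ij i' j' : (forall k, k = i' \/ k = j') -> i' != j' -> size (c' i') = 3 ->
    avoids (map (index^~ s) (c' i')) (map (index^~ s) (c' j')) ->
    split_link (fun i => cycle_image G (c' i)).
  move=> tw ij' ci3 av.
  apply: (@split_avoiding R _ _ irr tour _ ms _ c' i' j' tw) => //.
    by have := sc' j'; case: (c' j').
  exact: dis'.
(* Disjointness holds, so if [linked] fails then one of the two [avoids] tests succeeds, the second
   being available only between triangles. *)
have lk i' j' : i' != j' -> size (c' i') = 3 -> size (c' j') = 3 \/ size (c' j') = 4 ->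
    avoids (map (index^~ s) (c' i')) (map (index^~ s) (c' j')) \/
    size (c' j') = 3 /\ avoids (map (index^~ s) (c' j')) (map (index^~ s) (c' i')).
  move=> ij' si sj; have [_ _ _ hi _] := c'P i'; have [_ _ _ hj _] := c'P j'.
  have := nolink _ _ (ec' i') (uc' i') si hi (ec' j') (uc' j') sj hj.
  rewrite /linked /= size_map => /negP h.
  have [|a1] := boolP (avoids _ _); first by left.
  right; suff /andP[/eqP s3 a2] : (size (c' j') == 3) &&
    avoids (map (index^~ s) (c' j')) (map (index^~ s) (c' i')) by [].
  apply/negPn/negP => a2; apply: h; rewrite a1 /=; apply/andP; split; last first.
    by apply/implyP => s3; move: a2; rewrite s3.
  apply/hasPn => _ /mapP[v vj ->]; apply/negP => /mapP[u ui].
  move=> /(congr1 (nth u s)); rewrite !nth_index ?ms// => vu.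
  by have := disjointFr (dis' _ _ ij') ui; rewrite -vu vj.
have := le7 _ (ucat _ _ ij); rewrite size_cat => sz.
have [[si sj]|[si sj]|[si sj]] := sizes _ _ (sc' i) (sc' j) sz.
- have [a|[s3 a]] := lk i j ij si (or_introl sj); first exact: (split_ij i j).
  exact: (split_ij j i).
- have [a|[s3 a]] := lk i j ij si (or_intror sj); first exact: (split_ij i j).
  exact: (split_ij j i).
- have [a|[s3 a]] := lk j i ji sj (or_intror si); first exact: (split_ij j i).
  exact: (split_ij i j).
Qed.
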